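(* Let $f:\mathbb{R}^m\to\mathbb{R}$ be continuously differentiable, $\mathrm{RC}(\alpha,\beta)$ with $\alpha,\beta>0$, and have Lipschitz continuous gradient with constant $L$. Let $\mathcal{X}^*=\{x\in\mathbb{R}^m\mid\nabla f(x)=0\}$ be finite, and let the partial asynchrony assumption (given in the context) hold with a positive integer $B$. Let $x^*\in\mathcal{X}^*$ be a minimizer of $f$, and put $\mu=\frac{1}{\beta^2L}$. Then there exists $\gamma_0\in(0,1)$ such that for all $\gamma\in(0,\gamma_0)$ the sequence of true states $\{x(t)\}_{t\in\mathbb{N}}$ generated by the asynchronous block coordinate descent algorithm with stepsize $\gamma$ converges linearly to $x^*$, in the sense that $x(t)\to x^*$ and, for some finite constant $\eta>0$ and all $k=0,1,2,\dots$, $$f(x(kB))-f^*\le(1-\gamma\mu)^{k-1}\eta,\qquad \gamma^2\sum_{\tau=(k-1)B}^{kB-1}\|s(\tau)\|^2\le(1-\gamma\mu)^{k-1}\eta.$$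
   Context: Norms are Euclidean, $[n]:=\{1,\dots,n\}$, and $f^*:=\min_{x\in\mathbb{R}^m}f(x)$. $f$ satisfies the Regularity Condition $\mathrm{RC}(\alpha,\beta)$ with $\alpha,\beta>0$ if $$\langle\nabla f(z),z-x^*\rangle\ge\frac1\alpha\|\nabla f(z)\|^2+\frac1\beta\|z-x^*\|^2$$ for all $z\in\mathbb{R}^m$, where $x^*$ is a minimizer of $f$. Asynchronous block coordinate descent: there are $n$ processors; $x\in\mathbb{R}^m$ is decomposed as $x=(x_1,\dots,x_n)$ with $x_i\in\mathbb{R}^{m_i}$, $m=\sum_{i=1}^n m_i$, and $\nabla_i f=\partial f/\partial x_i$. Time $t$ ranges over the nonnegative integers $\mathbb{N}$. Processor $i$ stores a local copy $x^i(t)=(x^i_1(t),\dots,x^i_n(t))\in\mathbb{R}^m$. For each $i$ there is a set $T^i\subseteq\mathbb{N}$ of update times of processor $i$, and with stepsize $\gamma>0$, $$x^i_i(t+1)=\begin{cases}x^i_i(t)-\gamma\nabla_i f(x^i(t)) & t\in T^i,\\ x^i_i(t) & \text{otherwise.}\end{cases}$$ For $j\ne i$, $x^i_j(t)$ is a possibly outdated value of $x^j_j$: $x^i_j(t)=x^j_j(\tau^i_j(t))$, where $\tau^i_j(t)\in\mathbb{N}$, $\tau^i_j(t)\le t$, is the time at which processor $j$ computed the value held by processor $i$ at time $t$ (this value is replaced by $x^j_j(\tau^i_j(t+1))$ when processor $i$ receives a transmission from processor $j$ at time $t+1$, and is left unchanged otherwise). The true state is $x(t)=(x^1_1(t),x^2_2(t),\dots,x^n_n(t))$.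 Define $s_i(t)=-\nabla_i f(x^i(t))$ if $t\in T^i$ and $s_i(t)=0$ otherwise, and $s(t)=[s_1(t)^T,\dots,s_n(t)^T]^T$; thus $x(t+1)=x(t)+\gamma s(t)$. By convention $s(\tau)=0$ for $\tau<0$. Partial asynchrony assumption: there exists a positive integer $B$ such that (1) for every $i\in[n]$ and $t\in\mathbb{N}$, at least one element of $\{t,t+1,\dots,t+B-1\}$ is in $T^i$; (2) $t-B<\tau^i_j(t)\le t$ for all $i,j\in[n]$, $j\ne i$, and all $t\in T^i$. *)

(* Defs.v *)
From HB Require Import structures.
From mathcomp Require Import all_boot all_order all_algebra.
From mathcomp Require Import all_classical all_reals all_analysis.

Set Implicit Arguments.
Unset Strict Implicit.
Unset Printing Implicit Defensive.

Import Order.TTheory GRing.Theory Num.Theory.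
Import numFieldNormedType.Exports.

Local Open Scope classical_set_scope.
Local Open Scope ring_scope.

Definition edot (R : realType) (m : nat) (x y : 'rV[R]_m) : R :=
  \sum_(j < m) x 0 j * y 0 j.

(* The library norm on 'rV[R]_m is the sup norm; it induces the same topology
   as enorm, so library convergence, continuity and differentiability are the
   Euclidean ones, but quantitative bounds have to be stated with enorm. *)
Definition enorm (R : realType) (m : nat) (x : 'rV[R]_m) : R :=
  Num.sqrt (edot x x).

Definition grad (R : realType) (m : nat) (f : 'rV[R]_m -> R) (x : 'rV[R]_m) :
    'rV[R]_m :=
  \row_j 'D_(delta_mx 0 j) f x.

Definition continuously_differentiable (R : realType) (m : nat)
    (f : 'rV[R]_m -> R) : Prop :=
  (forall x, differentiable f x) /\ continuous (grad f).

Definition lipschitz_grad (R : realType) (m : nat) (L : R)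
    (f : 'rV[R]_m -> R) : Prop :=
  forall x y, enorm (grad f x - grad f y) <= L * enorm (x - y).

Definition minimizer (R : realType) (m : nat) (f : 'rV[R]_m -> R)
    (x : 'rV[R]_m) : Prop :=
  forall y, f x <= f y.

(* Meaningful only when f has a minimizer; it is then the minimum of f. *)
Definition min_value (R : realType) (m : nat) (f : 'rV[R]_m -> R) : R :=
  inf (range f).

Definition regularity_condition (R : realType) (m : nat) (alpha beta : R)
    (f : 'rV[R]_m -> R) : Prop :=
  exists2 xstar, minimizer f xstar &
    forall z, edot (grad f z) (z - xstar) >=
      alpha^-1 * enorm (grad f z) ^+ 2 + beta^-1 * enorm (z - xstar) ^+ 2.

(* Vectors x = (x_1, ..., x_n) with x_i in R^(m_i) are block row vectors;
   x_i is submxrow x i. *)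
Definition pgrad (R : realType) (n : nat) (m_ : 'I_n -> nat)
    (f : 'rV[R]_(\sum_(i < n) m_ i) -> R) (i : 'I_n)
    (x : 'rV[R]_(\sum_(i < n) m_ i)) : 'rV[R]_(m_ i) :=
  submxrow (grad f x) i.

(* [T i] is the set of update times of processor i, [X i t] its local copy at
   time t, and [tau i j t] the time at which processor j computed the value of
   block j held by processor i at time t. The value [tau i i t] is irrelevant.
   The initial state is unconstrained. *)
Definition async_bcd (R : realType) (n : nat) (m_ : 'I_n -> nat)
    (f : 'rV[R]_(\sum_(i < n) m_ i) -> R) (gamma : R)
    (T : 'I_n -> set nat) (tau : 'I_n -> 'I_n -> nat -> nat)
    (X : 'I_n -> nat -> 'rV[R]_(\sum_(i < n) m_ i)) : Prop :=
  (forall i t, submxrow (X i t.+1) i =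
     if t \in T i then submxrow (X i t) i - gamma *: pgrad f i (X i t)
     else submxrow (X i t) i) /\
  (forall i j t, j != i ->
     submxrow (X i t) j = submxrow (X j (tau i j t)) j).

Definition true_state (R : realType) (n : nat) (m_ : 'I_n -> nat)
    (X : 'I_n -> nat -> 'rV[R]_(\sum_(i < n) m_ i)) (t : nat) :
    'rV[R]_(\sum_(i < n) m_ i) :=
  \mxrow_i submxrow (X i t) i.

(* Indexed by int because of the convention s(t) = 0 for t < 0. *)
Definition update_direction (R : realType) (n : nat) (m_ : 'I_n -> nat)
    (f : 'rV[R]_(\sum_(i < n) m_ i) -> R) (T : 'I_n -> set nat)
    (X : 'I_n -> nat -> 'rV[R]_(\sum_(i < n) m_ i)) (t : int) :
    'rV[R]_(\sum_(i < n) m_ i) :=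
  match t with
  | Posz t => \mxrow_i (if t \in T i then - pgrad f i (X i t) else 0)
  | Negz _ => 0
  end.

Definition causal (n : nat) (tau : 'I_n -> 'I_n -> nat -> nat) : Prop :=
  forall i j t, j != i -> (tau i j t <= t)%N.

(* The lower bound t - B < tau is written additively: subtraction on nat
   truncates. *)
Definition partially_asynchronous (n B : nat) (T : 'I_n -> set nat)
    (tau : 'I_n -> 'I_n -> nat -> nat) : Prop :=
  (forall i t, exists2 u, (t <= u < t + B)%N & T i u) /\
  (forall i j t, j != i -> T i t -> (t < tau i j t + B)%N /\ (tau i j t <= t)%N).

(* Main.v *)
(* RC and the Lipschitz bound give the Polyak-Lojasiewicz inequality
   2 mu (f(z) - f^* ) <= |grad f(z)|^2, twice what the claimed rate needs. Over
   B consecutive steps every coordinate is updated at least once with a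
   gradient evaluated at a point whose distance to the current state is of order
   gamma, so a block of B steps decreases f by about gamma |grad f|^2, with
   errors of order gamma^2 P controlled by the energy P of the updates of this
   block and the previous one. The spare factor 2 absorbs these errors: for
   small gamma, f(x(t)) - f^* + A gamma^2 P(t), with P(t) the energy of the
   steps t - B, ..., t - 1, shrinks by 1 - gamma mu every B steps, for any
   starting time t. Since |z - x^*|^2 is bounded by a multiple of f(z) - f^*,
   the states converge. *)

Require Import Defs.
From HB Require Import structures.
From mathcomp Require Import all_boot all_order all_algebra.
From mathcomp Require Import all_classical all_reals all_analysis.
From mathcomp Require Import zify ring lra.

Set Implicit Arguments.
Unset Strict Implicit.
Unset Printing Implicit Defensive.

Import Order.TTheory GRing.Theory Num.Theory.
Import numFieldNormedType.Exports.

Local Open Scope classical_set_scope.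
Local Open Scope ring_scope.

(** * Displacement within a time window *)

Lemma sqr_sum_nat_le (R : realFieldType) (d : nat -> R) (a b : nat) :
  (\sum_(a <= u < b) d u) ^+ 2 <= (b - a)%:R * \sum_(a <= u < b) d u ^+ 2.
Proof.
have [ab|ba] := ltnP a b; last by rewrite !big_geq // expr0n mulr0.
have N_gt0 : 0 < (b - a)%:R :> R by rewrite ltr0n subn_gt0.
(* With [c] the mean of [d], the bound is the sum of the squares of [d u - c] being nonnegative. *)
set S := \sum_(a <= u < b) d u; pose c := S / (b - a)%:R.
have : \sum_(a <= u < b) 2 * c * d u <= \sum_(a <= u < b) (d u ^+ 2 + c ^+ 2).
  by apply: ler_sum => u _; have := sqr_ge0 (d u - c); lra.
rewrite -mulr_sumr big_split /= sumr_const_nat -[c ^+ 2 *+ _]mulr_natl -/S.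
have -> : S = (b - a)%:R * c by rewrite /c mulrCA divff ?mulr1 ?gt_eqF.
move: (\sum_(_ <= u < _) _) (_%:R) N_gt0 => Q N N_gt0 le_Q.
by rewrite exprMn expr2 -mulrA ler_pM2l //; lra.
Qed.

(** Telescoping and Cauchy-Schwarz. Enlarging the sum to the whole window gives one bound for all
    pairs of times in it, so coordinates with different delays share the same right-hand side. *)
Lemma sqr_dist_le (R : realFieldType) (y d : nat -> R) (gamma : R)
    (N p a b : nat) :
  (forall u, y u.+1 = y u + gamma * d u) ->
  (p <= a <= p + N)%N -> (p <= b <= p + N)%N ->
  (y a - y b) ^+ 2 <= gamma ^+ 2 * (N%:R * \sum_(p <= u < p + N) d u ^+ 2).
Proof.
move=> yS; wlog ab : a b / (a <= b)%N.
  move=> th ha hb; have [ab|/ltnW ba] := leqP a b; first exact: th.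
  by rewrite -sqrrN opprB; exact: th.
move=> /andP[pa aN] /andP[pb bN].
have -> : y a - y b = - (gamma * \sum_(a <= u < b) d u).
  rewrite -opprB -telescope_sumr // mulr_sumr; congr (- _).
  by apply: eq_bigr => u _; rewrite yS addrAC subrr add0r.
rewrite sqrrN exprMn ler_wpM2l ?sqr_ge0 //.
have sum_ge0 i j : 0 <= \sum_(i <= u < j) d u ^+ 2.
  by apply: sumr_ge0 => u _; exact: sqr_ge0.
apply: (le_trans (sqr_sum_nat_le d a b)).
apply: ler_pM => //; first by rewrite ler_nat; lia.
rewrite (big_cat_nat pa) /=; last by lia.
rewrite (big_cat_nat ab bN) /=.
by rewrite addrCA lerDl addr_ge0.
Qed.

(** * Euclidean geometry and derivatives along lines *)

Section Euclidean.
Variables (R : realType) (m : nat).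
Implicit Types u v w : 'rV[R]_m.

Lemma edot_ge0 v : 0 <= edot v v.
Proof. by apply: sumr_ge0 => j _; rewrite -expr2 sqr_ge0. Qed.

Lemma enorm_sqr v : enorm v ^+ 2 = edot v v.
Proof. by rewrite sqr_sqrtr ?edot_ge0. Qed.

Lemma edotBl u v w : edot (u - v) w = edot u w - edot v w.
Proof.
by rewrite -sumrB; apply: eq_bigr => j _; rewrite !mxE mulrBl.
Qed.

Lemma edotZr a u v : edot u (a *: v) = a * edot u v.
Proof. by rewrite mulr_sumr; apply: eq_bigr => j _; rewrite mxE mulrCA. Qed.

Lemma edotZZ a v : edot (a *: v) (a *: v) = a ^+ 2 * edot v v.
Proof. by rewrite mulr_sumr; apply: eq_bigr => j _; rewrite mxE; ring. Qed.

Lemma edotE v : edot v v = \sum_(j < m) v 0 j ^+ 2.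
Proof. by []. Qed.

Lemma sqr_coord_le v j : v 0 j ^+ 2 <= edot v v.
Proof.
rewrite edotE (bigD1 j) //= lerDl.
by apply: sumr_ge0 => k _; exact: sqr_ge0.
Qed.

Lemma edot_eq0 v : edot v v <= 0 -> v = 0.
Proof.
move=> v0; apply/rowP => j; rewrite mxE; apply/eqP.
rewrite -sqrf_eq0 eq_le sqr_ge0 andbT.
exact: le_trans (sqr_coord_le v j) v0.
Qed.

Lemma edot_young c u v : 0 < c ->
  edot u v <= (c * edot u u + c^-1 * edot v v) / 2.
Proof.
move=> c0; have cV0 : 0 < c^-1 by rewrite invr_gt0.
have ccV : c * c^-1 = 1 by rewrite divff ?gt_eqF.
rewrite !mulr_sumr -big_split mulr_suml; apply: ler_sum => j _ /=.
set a := u 0 j; set b := v 0 j.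
rewrite -subr_ge0; suff -> : (c * (a * a) + c^-1 * (b * b)) / 2 - a * b
  = c / 2 * (a - c^-1 * b) ^+ 2 by rewrite mulr_ge0 ?sqr_ge0 ?divr_ge0 ?ltW.
by field; rewrite gt_eqF.
Qed.

Lemma mx_norm_le_enorm v : `|v| <= enorm v.
Proof.
rewrite [`|v|]mx_normE.
elim/big_ind: _ => [|x y hx hy|[i j] _] /=; first exact: sqrtr_ge0.
  by rewrite num_max ge_max hx.
rewrite ord1 -sqrtr_sqr ler_wsqrtr //; exact: sqr_coord_le.
Qed.

Section Gradient.
Variable f : 'rV[R]_m -> R.
Hypothesis f_diff : forall x, differentiable f x.

Lemma deriveE_grad x v : 'D_v f x = edot (grad f x) v.
Proof.
rewrite deriveE // {1}(row_sum_delta v) linear_sum; apply: eq_bigr => j _.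
by rewrite linearZ /= mxE deriveE // mulrC.
Qed.

Lemma is_derive_line x v (t : R) :
  is_derive t 1 (fun r : R => f (x + r *: v)) (edot (grad f (x + t *: v)) v).
Proof.
rewrite -deriveE_grad.
have E : (fun h : R => h^-1 *: (((fun r : R => f (x + r *: v)) \o shift t)
           (h *: 1) - f (x + t *: v))) =
         (fun h : R => h^-1 *: ((f \o shift (x + t *: v)) (h *: v)
                                - f (x + t *: v))).
  apply/funext => h /=; congr (_ *: (f _ - _)).
  by rewrite [h *: 1]mulr1 scalerDl addrCA addrA.
have D := diff_derivable (v := v) (f_diff (x + t *: v)).
apply: DeriveDef; first by rewrite /derivable E.
by rewrite /derive E.
Qed.

End Gradient.
End Euclidean.

(** * Descent lemma, error bound and Polyak-Lojasiewicz inequality *)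

Section LipschitzGradient.
Variables (R : realType) (m : nat) (f : 'rV[R]_m -> R) (L : R).
Hypothesis f_diff : forall x, differentiable f x.
Hypothesis L_gt0 : 0 < L.
Hypothesis f_lip : lipschitz_grad L f.

Lemma grad_dist_sqr x y :
  edot (grad f x - grad f y) (grad f x - grad f y)
    <= L ^+ 2 * edot (x - y) (x - y).
Proof.
rewrite -!enorm_sqr -exprMn ler_sqr ?nnegrE ?sqrtr_ge0 ?f_lip //.
by rewrite mulr_ge0 ?sqrtr_ge0 ?ltW.
Qed.

Lemma descent x v :
  f (x + v) <= f x + edot (grad f x) v + L / 2 * edot v v.
Proof.
set a := edot (grad f x) v; set q := edot v v.
(* [h] is [f] along the segment minus the linear and quadratic terms of the bound, so the claim is
   [h 1 <= h 0], and a nonpositive derivative at the mean value point suffices. *)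
pose h (r : R) := f (x + r *: v) - a * r - L / 2 * q * (r * r).
pose dh (r : R) := edot (grad f (x + r *: v)) v - a - L / 2 * q * (r + r).
have hP (r : R) : is_derive r 1 h (dh r).
  have fP := is_derive_line f_diff x v r.
  by apply: is_derive_eq; rewrite /dh /GRing.scale /=; ring.
have h_cont : {within `[(0 : R), 1], continuous h}.
  apply: continuous_subspaceT => r; apply: differentiable_continuous.
  by apply/derivable1_diffP; apply: ex_derive; exact: hP.
have [c] := MVT ltr01 (fun r _ => hP r) h_cont.
rewrite in_itv /= => /andP[c0 _].
rewrite subr0 mulr1 /h scale0r addr0 scale1r => hE.
suff : dh c <= 0 by move: hE; lra.
have Lc_gt0 : 0 < L * c by rewrite mulr_gt0.
(* The weight [1 / (L c)] balances Young's inequality: both halves are then at most [L c q / 2], and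
   the total [L c q] is exactly what [dh c] subtracts. *)
have := edot_young (grad f (x + c *: v) - grad f x) v (c := (L * c)^-1).
rewrite invr_gt0 => /(_ Lc_gt0); rewrite invrK edotBl -/a -/q.
have := grad_dist_sqr (x + c *: v) x; rewrite addrAC subrr add0r edotZZ -/q.
rewrite mulrA -exprMn expr2 -[_ * _ * q]mulrA -ler_pdivrMl // /dh.
by set A := _^-1 * _; lra.
Qed.

Section Minimizer.
Variable xstar : 'rV[R]_m.
Hypothesis xstar_crit : grad f xstar = 0.
Hypothesis xstar_min : minimizer f xstar.

Lemma suboptimality_le z :
  f z - f xstar <= L / 2 * edot (z - xstar) (z - xstar).
Proof.
have := descent xstar (z - xstar); rewrite xstar_crit addrC subrK.
suff -> : edot 0 (z - xstar) = 0 by lra.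
by apply: big1 => j _; rewrite mxE mul0r.
Qed.

(* One exact gradient step of length 1/L cannot go below the minimum. *)
Lemma grad_sqr_le z :
  edot (grad f z) (grad f z) <= 2 * L * (f z - f xstar).
Proof.
have := descent z (- L^-1 *: grad f z); rewrite edotZr edotZZ.
have := xstar_min (z + - L^-1 *: grad f z).
set g := edot _ _ => le1 le2; have := le_trans le1 le2.
have -> : f z + - L^-1 * g + L / 2 * ((- L^-1) ^+ 2 * g) =
  f z - g / (2 * L) by field; rewrite gt_eqF.
rewrite lerBrDr addrC -lerBrDr ler_pdivrMr ?mulr_gt0 //.
by rewrite [in leRHS]mulrC.
Qed.

Lemma min_valueE : min_value f = f xstar.
Proof.
apply/eqP; rewrite eq_le; apply/andP; split.
  apply: ge_inf; last by exists xstar.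
  by exists (f xstar) => _ [z _ <-]; exact: xstar_min.
apply: lb_le_inf; first by exists (f xstar), xstar.
by move=> _ [z _ <-]; exact: xstar_min.
Qed.

Section Regularity.
Variables alpha beta : R.
Hypotheses (alpha_gt0 : 0 < alpha) (beta_gt0 : 0 < beta).
Hypothesis f_RC : regularity_condition alpha beta f.

(** The regularity condition only provides some minimizer [x0]; testing it at the critical point
    [xstar] forces [x0 = xstar]. Young's inequality with weight [beta] then absorbs half of the
    distance term. *)
Lemma dist_sqr_le_grad z :
  edot (z - xstar) (z - xstar) <= beta ^+ 2 * edot (grad f z) (grad f z).
Proof.
case: f_RC => x0 _ RC.
have bV : 0 < beta^-1 by rewrite invr_gt0.
have grad_ge0 y : 0 <= alpha^-1 * edot (grad f y) (grad f y).
  by rewrite mulr_ge0 ?edot_ge0 // invr_ge0 ltW.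
have RC' y : beta^-1 * edot (y - x0) (y - x0) <= edot (grad f y) (y - x0).
  by have := RC y; rewrite !enorm_sqr; have := grad_ge0 y; lra.
have x0E : x0 = xstar.
  apply/eqP; rewrite eq_sym -subr_eq0; apply/eqP/edot_eq0.
  rewrite -(pmulr_rle0 _ bV); apply: le_trans (RC' xstar) _.
  by rewrite xstar_crit /edot big1 // => j _; rewrite mxE mul0r.
rewrite -x0E; have := RC' z; have := edot_young (grad f z) (z - x0) beta_gt0.
set g := edot (grad f z) (grad f z); set w := edot (z - x0) _ => le1 le2.
have {le1 le2} : beta^-1 * w <= beta * g by have := le_trans le2 le1; lra.
by rewrite mulrC ler_pdivrMr // mulrAC -expr2.
Qed.

(** The Polyak-Lojasiewicz inequality: the quadratic upper bound at [xstar] chained with the bound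
    of the distance by the gradient. *)
Lemma suboptimality_le_grad z :
  2 * (1 / (beta ^+ 2 * L)) * (f z - f xstar) <= edot (grad f z) (grad f z).
Proof.
have c_gt0 : 0 < beta ^+ 2 * L by rewrite mulr_gt0 ?exprn_gt0.
have h1 := suboptimality_le z; have h2 := dist_sqr_le_grad z.
have h3 : L / 2 * edot (z - xstar) (z - xstar) <=
  L / 2 * (beta ^+ 2 * edot (grad f z) (grad f z)).
  by rewrite ler_pM2l // divr_gt0.
rewrite mulrAC mulrA mulr1 ler_pdivrMr //; lra.
Qed.

(** Turns decay of the function values into convergence of the states. *)
Lemma dist_sqr_le z :
  edot (z - xstar) (z - xstar) <= 2 * L * beta ^+ 2 * (f z - f xstar).
Proof.
apply: le_trans (dist_sqr_le_grad z) _; rewrite [leLHS]mulrC [leRHS]mulrAC.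
by rewrite ler_pM2r ?exprn_gt0 // grad_sqr_le.
Qed.

End Regularity.
End Minimizer.
End LipschitzGradient.

(** * Lyapunov decrease for descent with delayed gradients *)

Section DelayedDescent.
Variables (R : realType) (m : nat) (f : 'rV[R]_m -> R) (L mu gamma : R).
Variables (B : nat) (y d : nat -> 'rV[R]_m) (fmin : R).
Hypothesis f_diff : forall x, differentiable f x.
Hypothesis L_gt0 : 0 < L.
Hypothesis f_lip : lipschitz_grad L f.
Hypothesis f_PL :
  forall z, 2 * mu * (f z - fmin) <= edot (grad f z) (grad f z).
Hypothesis B_gt0 : (0 < B)%N.
Hypothesis gamma_gt0 : 0 < gamma.
Hypothesis yS : forall u, y u.+1 = y u + gamma *: d u.

(* Indices of y and d are shifted by B, so that index t + B is time t and no
   time in the delay window is negative. *)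
Definition stale_update (t : nat) (c : 'I_m) :=
  exists2 Z : 'rV[R]_m,
    forall j, exists2 a, (t <= a <= t + B)%N & Z 0 j = y a 0 j
    & d (t + B)%N 0 c = - grad f Z 0 c.

Hypothesis d_idle_or_stale :
  forall t c, d (t + B)%N 0 c = 0 \/ stale_update t c.
Hypothesis d_active :
  forall t c, exists2 u, (t <= u < t + B)%N & stale_update u c.

Let energy (a b : nat) := \sum_(a <= u < b) edot (d u) (d u).

Let energy_ge0 a b : 0 <= energy a b.
Proof. by apply: sumr_ge0 => u _; exact: edot_ge0. Qed.

Let energy_cat t :
  energy t (t + (B + B))%N =
    energy t (t + B)%N + energy (t + B)%N (t + B + B)%N.
Proof. by rewrite /energy addnA -big_cat_nat ?leq_addr. Qed.

(** [p] and all the indices from which [Z] is assembled lie in the window from [t] to [t + 2B].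
    Displacements are therefore bounded coordinate by coordinate by the energy of that window, and
    the Lipschitz bound transfers this to gradients. *)
Let gradient_error (t r : nat) (c : 'I_m) (p : nat) :
  (t <= r < t + B)%N -> (t <= p <= t + (B + B))%N -> stale_update r c ->
  (grad f (y p) 0 c + d (r + B)%N 0 c) ^+ 2 <=
    gamma ^+ 2 * (2 * L ^+ 2 * B%:R * energy t (t + (B + B))%N).
Proof.
move=> tr tp [Z ZE ->]; set W := energy _ _.
have dist_le : edot (y p - Z) (y p - Z) <= gamma ^+ 2 * ((B + B)%:R * W).
  rewrite edotE /W /energy exchange_big /= !mulr_sumr; apply: ler_sum => j _.
  rewrite 2!mxE; have [a ra ->] := ZE j.
  have yjS u : y u.+1 0 j = y u 0 j + gamma * d u 0 j by rewrite yS 2!mxE.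
  by apply: (sqr_dist_le yjS) => //; lia.
have le1 : (grad f (y p) 0 c - grad f Z 0 c) ^+ 2 <=
    edot (grad f (y p) - grad f Z) (grad f (y p) - grad f Z).
  by have := sqr_coord_le (grad f (y p) - grad f Z) c; rewrite !mxE.
have le2 := grad_dist_sqr L_gt0 f_lip (y p) Z.
apply: (le_trans le1); apply: (le_trans le2).
have -> : gamma ^+ 2 * (2 * L ^+ 2 * B%:R * W) =
  L ^+ 2 * (gamma ^+ 2 * ((B + B)%:R * W)) by rewrite natrD; ring.
by rewrite ler_pM2l // exprn_gt0.
Qed.

Let step_descent t r : (t <= r < t + B)%N ->
  f (y (r + B)%N.+1) <= f (y (r + B)%N)
    - gamma * (1 - gamma * ((1 + L) / 2)) * edot (d (r + B)%N) (d (r + B)%N)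
    + gamma ^+ 2 * (m%:R * L ^+ 2 * B%:R * energy t (t + (B + B))%N).
Proof.
move=> tr; set W := energy _ _.
have W_ge0 : 0 <= W by exact: energy_ge0.
have coord c : grad f (y (r + B)%N) 0 c * (gamma * d (r + B)%N 0 c) <=
    - gamma * (1 - gamma / 2) * (d (r + B)%N 0 c * d (r + B)%N 0 c)
    + gamma ^+ 2 * (L ^+ 2 * B%:R * W).
  have [->|st] := d_idle_or_stale r c.
    rewrite !mulr0 add0r; apply: mulr_ge0; first exact: sqr_ge0.
    by apply: mulr_ge0 => //; apply: mulr_ge0; rewrite ?sqr_ge0 ?ler0n.
  have := gradient_error tr (p := (r + B)%N) _ st.
  have -> : (t <= r + B <= t + (B + B))%N by lia.
  move=> /(_ isT); rewrite -/W.
  set g := grad f _ 0 c; set e := d _ 0 c => le1.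
  (* Young's inequality pairing the gradient error [g + e] with [gamma * e]; the squared error is
     already of order [gamma ^+ 2]. *)
  have := sqr_ge0 (g + e - gamma * e); lra.
rewrite yS; apply: le_trans (descent f_diff L_gt0 f_lip _ _) _.
rewrite edotZZ -!addrA lerD2l -lerBrDr.
have -> : edot (grad f (y (r + B)%N)) (gamma *: d (r + B)%N) =
  \sum_c grad f (y (r + B)%N) 0 c * (gamma * d (r + B)%N 0 c).
  by apply: eq_bigr => c _; congr (_ * _); rewrite mxE.
apply: le_trans (ler_sum _ (fun c _ => coord c)) _.
rewrite big_split /= -mulr_sumr -/(edot _ _) sumr_const card_ord -mulr_natl.
by set q := edot _ _; lra.
Qed.

Let block_descent t :
  f (y (t + B + B)%N) <= f (y (t + B)%N)
    - gamma * (1 - gamma * ((1 + L) / 2)) * energy (t + B)%N (t + B + B)%N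
    + gamma ^+ 2 * (m%:R * L ^+ 2 * B%:R ^+ 2 * energy t (t + (B + B))%N).
Proof.
set W := energy t _.
(* The window of [W] stays fixed while [N] grows, so the step errors simply add up. *)
suff H N : (N <= B)%N -> f (y (t + B + N)%N) <= f (y (t + B)%N)
    - gamma * (1 - gamma * ((1 + L) / 2)) * energy (t + B)%N (t + B + N)%N
    + N%:R * (gamma ^+ 2 * (m%:R * L ^+ 2 * B%:R * W)).
  apply: le_trans (H B (leqnn B)) _; lra.
elim: N => [|N IH] NB.
  by rewrite addn0 /energy big_geq // !mulr0 mul0r subr0 addr0.
have := IH (ltnW NB); have := @step_descent t (t + N)%N; rewrite -/W.
have -> : (t <= t + N < t + B)%N by lia.
move=> /(_ isT); rewrite addnS addnAC -addn1 /energy.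
rewrite addn1 big_nat_recr ?leq_addr //= -natr1.
by rewrite -/(energy _ _); lra.
Qed.

Let gradient_le t :
  edot (grad f (y (t + B)%N)) (grad f (y (t + B)%N)) <=
    3 / 2 * energy (t + B)%N (t + B + B)%N
    + gamma ^+ 2 * (6 * m%:R * L ^+ 2 * B%:R * energy t (t + (B + B))%N).
Proof.
set W := energy t _.
have coord c : grad f (y (t + B)%N) 0 c ^+ 2 <=
    3 / 2 * (\sum_(t + B <= u < t + B + B) d u 0 c ^+ 2)
    + gamma ^+ 2 * (6 * L ^+ 2 * B%:R * W).
  have [r tr st] := d_active t c.
  have := gradient_error tr (p := (t + B)%N) _ st.
  have -> : (t <= t + B <= t + (B + B))%N by lia.
  move=> /(_ isT); rewrite -/W.
  have : d (r + B)%N 0 c ^+ 2 <= \sum_(t + B <= u < t + B + B) d u 0 c ^+ 2.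
    rewrite (big_rem (r + B)%N) ?mem_index_iota /=; last by lia.
    by rewrite lerDl sumr_ge0 // => u _; exact: sqr_ge0.
  set g := grad f _ 0 c; set e := d _ 0 c; set S := \sum_(_ <= _ < _) _.
  (* Half of this square is the gap in [g^2 <= 3/2 e^2 + 3 (g + e)^2]. A coefficient below 2 in
     front of [e^2] is essential for the contraction. *)
  by have := sqr_ge0 (2 * g + 3 * e); lra.
rewrite edotE; apply: le_trans (ler_sum _ (fun c _ => coord c)) _.
rewrite big_split /= -mulr_sumr exchange_big /= -/(energy _ _).
rewrite sumr_const card_ord -[_ *+ m]mulr_natl; lra.
Qed.

Definition lyapunov (A : R) (t : nat) :=
  f (y (t + B)%N) - fmin
  + A * (gamma ^+ 2 * \sum_(t <= u < t + B) edot (d u) (d u)).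

(** Let [P] and [Q] be the energies of the previous and the current block. Half of [a1] pays for
    [gamma * mu * (F0 - fmin)] with [3/4 gamma Q] and, by [a2], an error [3 C gamma^2 (P + Q)].
    Together with the block error this costs [4 C gamma^2 P], which half of the coefficient
    [8 C + 1] covers; the remaining [gamma Q / 4] covers all terms in [gamma^2 Q]. *)
Lemma lyapunov_contracts t : let C := m%:R * L ^+ 2 * B%:R ^+ 2 in
  0 < mu -> gamma * (2 + 2 * mu + 4 * (L + 12 * C + 2)) < 1 ->
  lyapunov (8 * C + 1) (t + B)%N <= (1 - gamma * mu) * lyapunov (8 * C + 1) t.
Proof.
move=> C mu_gt0 gamma_small; rewrite /lyapunov -!/(energy _ _).
have h1 := block_descent t; have h2 := gradient_le t.
have h3 := f_PL (y (t + B)%N).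
have B_ge1 : 1 <= B%:R :> R by rewrite ler1n.
have mL_ge0 : 0 <= m%:R * L ^+ 2 * B%:R :> R by rewrite !mulr_ge0 // ltW.
have C_ge : m%:R * L ^+ 2 * B%:R <= C.
  by rewrite /C [B%:R ^+ 2]expr2 mulrA ler_peMr.
move: h1 h2 h3; rewrite !energy_cat -/C.
have := energy_ge0 t (t + B)%N; have := energy_ge0 (t + B)%N (t + B + B)%N.
move: (energy _ _) (energy _ _) => P Q.
set F1 := f _; set F0 := f (y (t + B)%N); set G := edot _ _ => Q0 P0 h1 h2 h3.
have C_ge0 : 0 <= C by exact: le_trans C_ge.
have W_ge0 : 0 <= P + Q by exact: addr_ge0.
have h2' : G <= 3 / 2 * Q + gamma ^+ 2 * (6 * C * (P + Q)).
  apply: le_trans h2 _; rewrite lerD2l ler_pM2l ?exprn_gt0 //.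
  by rewrite ler_wpM2r //; lra.
clearbody C.
have [s1 s2 s3] : [/\ gamma <= 1, gamma * mu <= 1 / 2 &
     gamma * ((1 + L) / 2 + 4 * C + (8 * C + 1)) <= 1 / 4].
  have g_gt0 := gamma_gt0; have g_small := gamma_small.
  have := mulr_gt0 g_gt0 mu_gt0; have := mulr_gt0 g_gt0 L_gt0.
  by have := mulr_ge0 (ltW g_gt0) C_ge0 => gC gL gmu; split; lra.
have P2_ge0 : 0 <= gamma ^+ 2 * P by rewrite mulr_ge0 ?sqr_ge0.
have a1 : gamma * (2 * mu * (F0 - fmin)) <=
    gamma * (3 / 2 * Q + gamma ^+ 2 * (6 * C * (P + Q))).
  by rewrite ler_pM2l // (le_trans h3).
have a2 : gamma * (gamma ^+ 2 * (6 * C * (P + Q))) <=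
    gamma ^+ 2 * (6 * C * (P + Q)).
  by rewrite ler_piMl // mulr_ge0 ?sqr_ge0 // !mulr_ge0.
have a3 : gamma * mu * ((8 * C + 1) * (gamma ^+ 2 * P)) <=
    1 / 2 * ((8 * C + 1) * (gamma ^+ 2 * P)).
  by rewrite ler_wpM2r // mulr_ge0 // addr_ge0 // mulr_ge0.
have a4 : gamma * ((1 + L) / 2 + 4 * C + (8 * C + 1)) * (gamma * Q) <=
    1 / 4 * (gamma * Q).
  by rewrite ler_wpM2r // mulr_ge0 // ltW.
lra.
Qed.

End DelayedDescent.

(** * From blockwise contraction to convergence *)

Lemma geometric_decay (R : realFieldType) (V : nat -> R) (rho : R) (B : nat) :
  0 <= rho -> (forall t, V (t + B)%N <= rho * V t) ->
  forall r k, V (r + k * B)%N <= rho ^+ k * V r.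
Proof.
move=> rho_ge0 VB r; elim=> [|k IH]; first by rewrite mul0n addn0 mul1r.
rewrite mulSn addnCA addnC exprS -mulrA.
by apply: le_trans (VB _) _; rewrite ler_wpM2l.
Qed.

Lemma cvg_of_geometric_bound (R : realType) (m : nat) (x : nat -> 'rV[R]_m)
    (l : 'rV[R]_m) (K rho : R) (B : nat) :
  (0 < B)%N -> 0 <= rho < 1 ->
  (forall t, edot (x t - l) (x t - l) <= K * rho ^+ (t %/ B)) ->
  x t @[t --> \oo] --> l.
Proof.
move=> B_gt0 /andP[rho_ge0 rho_lt1] xl; apply/cvgrPdist_le => e e_gt0.
(* The hypothesis bounds squared distances, hence the tolerance [e ^+ 2]. *)
have := @cvg_geometric R K rho; rewrite ger0_norm // => /(_ rho_lt1).
move=> /cvgrPdist_le /(_ (e ^+ 2)); rewrite exprn_gt0 // => /(_ isT) [N _ NP].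
exists (N * B)%N => // t /= tN.
rewrite distrC; apply: le_trans (mx_norm_le_enorm _) _.
rewrite -ler_sqr ?nnegrE ?sqrtr_ge0 ?(ltW e_gt0) // enorm_sqr.
apply: le_trans (xl t) _; have := NP (t %/ B)%N.
rewrite /= leq_divRL // => /(_ tN); rewrite sub0r normrN.
exact: le_trans (ler_norm _).
Qed.

(** * The asynchronous algorithm as delayed coordinate descent *)

Section BlockCoordinates.
Variables (R : realType) (n : nat) (m_ : 'I_n -> nat).
Variables (f : 'rV[R]_(\sum_(i < n) m_ i) -> R) (gamma : R).
Variables (T : 'I_n -> set nat) (tau : 'I_n -> 'I_n -> nat -> nat).
Variable X : 'I_n -> nat -> 'rV[R]_(\sum_(i < n) m_ i).
Hypothesis X_bcd : async_bcd f gamma T tau X.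

Let owner (c : 'I_(\sum_(i < n) m_ i)) : 'I_n := tagnat.sig1 c.

Let submxrow_sig (v : 'rV[R]_(\sum_(i < n) m_ i)) c :
  submxrow v (owner c) 0 (tagnat.sig2 c) = v 0 c.
Proof. by rewrite mxE tagnat.sig2K. Qed.

Lemma true_state_coord t c : true_state X t 0 c = X (owner c) t 0 c.
Proof. by rewrite [LHS]mxE submxrow_sig. Qed.

Lemma update_direction_coord (t : nat) c : update_direction f T X t 0 c =
  if t \in T (owner c) then - grad f (X (owner c) t) 0 c else 0.
Proof.
rewrite [LHS]mxE; case: ifP => _; last by rewrite mxE.
by rewrite [LHS]mxE submxrow_sig.
Qed.

Lemma true_stateS t :
  true_state X t.+1 = true_state X t + gamma *: update_direction f T X t.
Proof.
apply/rowP => c; rewrite [RHS]mxE [X in _ = _ + X]mxE.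
rewrite !true_state_coord update_direction_coord -[LHS]submxrow_sig.
rewrite X_bcd.1; case: ifP => _; last by rewrite submxrow_sig mulr0 addr0.
rewrite [LHS]mxE [X in _ + X]mxE [X in - X]mxE submxrow_sig.
by rewrite submxrow_sig mulrN.
Qed.

Lemma outdated_coord i t c : owner c != i ->
  X i t 0 c = true_state X (tau i (owner c) t) 0 c.
Proof.
move=> ci; rewrite true_state_coord -[LHS]submxrow_sig (X_bcd.2 _ _ _ ci).
exact: submxrow_sig.
Qed.

Variable B : nat.
Hypothesis asyncB : partially_asynchronous B T tau.

(* Truncated subtraction freezes the state at its initial value for the first
   B indices, matching s = 0 at negative times. *)
Definition shifted_state (u : nat) := true_state X (u - B)%N.
Definition shifted_direction (u : nat) :=
  update_direction f T X (u%:Z - B%:Z).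

Lemma shifted_stateS u :
  shifted_state u.+1 = shifted_state u + gamma *: shifted_direction u.
Proof.
(* For [u < B], including [u = B - 1], both states are the initial one and the direction has a
   negative time. *)
rewrite /shifted_state /shifted_direction; have [uB|Bu] := ltnP u B.
  have -> : (u.+1 - B = 0)%N by lia.
  have -> : (u - B = 0)%N by lia.
  have -> : u%:Z - B%:Z = Negz (B - u).-1 by lia.
  by rewrite scaler0 addr0.
by rewrite subSn // true_stateS -subzn.
Qed.

Lemma shifted_directionE t :
  shifted_direction (t + B) = update_direction f T X t.
Proof. by rewrite /shifted_direction PoszD addrK. Qed.

(** The stale point is the local copy of the processor owning [c]: its own block is current, and the
    others have delay below [B]. Adding [B] to the times puts them in the required window. *)
Lemma update_is_stale t c : T (owner c) t ->
  stale_update f B shifted_state shifted_direction t c.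
Proof.
move=> Tt; exists (X (owner c) t); last first.
  rewrite shifted_directionE update_direction_coord ifT //.
  by rewrite in_setE.
move=> j; rewrite /shifted_state; have [jc|jc] := eqVneq (owner j) (owner c).
  by exists (t + B)%N; rewrite ?leqnn ?leq_addr // addnK true_state_coord jc.
have [lo hi] := asyncB.2 _ _ _ jc Tt.
exists (tau (owner c) (owner j) t + B)%N; first by rewrite ltnW //= leq_add2r.
by rewrite addnK outdated_coord.
Qed.

Lemma idle_or_stale t c : shifted_direction (t + B) 0 c = 0 \/
  stale_update f B shifted_state shifted_direction t c.
Proof.
have [Tt|Tt] := boolP (t \in T (owner c)).
  by right; apply: update_is_stale; rewrite -in_setE.
by left; rewrite shifted_directionE update_direction_coord (negbTE Tt).
Qed.

Lemma eventually_stale t c : exists2 u, (t <= u < t + B)%N &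
  stale_update f B shifted_state shifted_direction u c.
Proof.
have [u tu Tu] := asyncB.1 (owner c) t.
by exists u => //; exact: update_is_stale.
Qed.

End BlockCoordinates.

(** * Choice of the stepsize bound and linear convergence *)

Theorem theorem2 (R : realType) (n : nat) (m_ : 'I_n -> nat)
    (f : 'rV[R]_(\sum_(i < n) m_ i) -> R) (alpha beta L : R)
    (B : nat) (T : 'I_n -> set nat) (tau : 'I_n -> 'I_n -> nat -> nat)
    (xstar : 'rV[R]_(\sum_(i < n) m_ i))
    (f_C1 : continuously_differentiable f)
    (alpha_gt0 : 0 < alpha) (beta_gt0 : 0 < beta)
    (f_RC : regularity_condition alpha beta f)
    (L_gt0 : 0 < L) (f_lip : lipschitz_grad L f)
    (crit_finite : finite_set [set x | grad f x = 0])
    (tau_causal : causal tau)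
    (B_gt0 : (0 < B)%N) (asyncB : partially_asynchronous B T tau)
    (xstar_crit : grad f xstar = 0) (xstar_min : minimizer f xstar) :
  let mu := 1 / (beta ^+ 2 * L) in
  exists gamma0 : R, 0 < gamma0 < 1 /\
    forall gamma : R, 0 < gamma < gamma0 ->
    forall X : 'I_n -> nat -> 'rV[R]_(\sum_(i < n) m_ i),
      async_bcd f gamma T tau X ->
      let x := true_state X in
      let s := update_direction f T X in
      x t @[t --> \oo] --> xstar /\
      exists eta : R, 0 < eta /\
        forall k : nat,
          f (x (k * B)%N) - min_value f
            <= (1 - gamma * mu) ^ (k%:Z - 1) * eta /\
          gamma ^+ 2 * (\sum_(0 <= l < B)
              enorm (s ((k%:Z - 1) * B%:Z + l%:Z)) ^+ 2)
            <= (1 - gamma * mu) ^ (k%:Z - 1) * eta.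
Proof.
move=> mu; set m := (\sum_(i < n) m_ i)%N.
pose C : R := m%:R * L ^+ 2 * B%:R ^+ 2.
pose D := 2 + 2 * mu + 4 * (L + 12 * C + 2).
have mu_gt0 : 0 < mu by rewrite divr_gt0 // mulr_gt0 // exprn_gt0.
have C_ge0 : 0 <= C by rewrite mulr_ge0 ?sqr_ge0 // mulr_ge0 ?sqr_ge0.
have D_gt1 : 1 < D by rewrite /D; lra.
have D_gt0 : 0 < D by exact: lt_trans D_gt1.
(* [D] is the factor in the smallness condition of [lyapunov_contracts]; [1 < D] puts its inverse
   below 1. *)
exists D^-1; rewrite invr_gt0 D_gt0 invf_lt1 //; split=> //.
move=> gamma /andP[gamma_gt0].
rewrite -[D^-1]mul1r ltr_pdivlMr // => gamma_small.
move=> X X_bcd x s.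
set rho := 1 - gamma * mu.
have rho_itv : 0 < rho < 1.
  have : 0 < gamma * mu by rewrite mulr_gt0.
  have : 0 <= gamma * (L + 12 * C + 2) by rewrite mulr_ge0 ?ltW //; lra.
  by move: gamma_small; rewrite /rho /D => ? ? ?; apply/andP; split; lra.
have /andP[rho_gt0 rho_lt1] := rho_itv.
pose y := shifted_state X B; pose d := shifted_direction f T X B.
pose V := lyapunov f gamma B y d (f xstar) (8 * C + 1).
have V_contracts t : V (t + B)%N <= rho * V t.
  apply: (lyapunov_contracts f_C1.1 L_gt0 f_lip) => //.
  - by apply: suboptimality_le_grad f_RC => //; exact: f_C1.1.
  - exact: (shifted_stateS X_bcd).
  - exact: (idle_or_stale X_bcd asyncB).
  - exact: (eventually_stale X_bcd asyncB).
have V_decay := geometric_decay (ltW rho_gt0) V_contracts.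
have energy_ge0 t : 0 <= gamma ^+ 2 * \sum_(t <= u < t + B) edot (d u) (d u).
  by rewrite mulr_ge0 ?sqr_ge0 // sumr_ge0 // => u _; exact: edot_ge0.
have f_le_V t : f (x t) - f xstar <= V t.
  rewrite /V /lyapunov /y /shifted_state addnK lerDl.
  by rewrite mulr_ge0 ?energy_ge0 // addr_ge0 // mulr_ge0.
(* Holds because the energy coefficient [8 * C + 1] is at least 1. *)
have energy_le_V t :
    gamma ^+ 2 * \sum_(t <= u < t + B) edot (d u) (d u) <= V t.
  have := mulr_ge0 C_ge0 (energy_ge0 t); have := xstar_min (y (t + B)%N).
  by rewrite /V /lyapunov; have := energy_ge0 t; lra.
have V_ge0 t : 0 <= V t by exact: le_trans (energy_le_V t).
rewrite (min_valueE xstar_min); split.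
  (* The contraction links times that are congruent modulo [B]; [M] dominates the initial values of
     all [B] residue classes. *)
  pose M := \sum_(r < B) V r.
  apply: (@cvg_of_geometric_bound _ _ _ _ (2 * L * beta ^+ 2 * M) rho B) => //.
    by rewrite (ltW rho_gt0).
  move=> t; have := dist_sqr_le f_C1.1 L_gt0 f_lip xstar_crit xstar_min
    alpha_gt0 beta_gt0 f_RC (x t).
  move=> /le_trans; apply; rewrite -[leRHS]mulrA ler_pM2l; last first.
    by rewrite !mulr_gt0 ?exprn_gt0.
  apply: le_trans (f_le_V t) _; rewrite {1}(divn_eq t B) addnC mulrC.
  apply: le_trans (V_decay _ _) _; rewrite ler_pM2l ?exprn_gt0 //.
  rewrite /M (bigD1 (Ordinal (ltn_pmod t B_gt0))) //= lerDl.
  by apply: sumr_ge0 => r _.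
(* The summand 1 makes the constant positive even if [V 0] vanishes. *)
exists (V 0%N + 1); split; first by rewrite ltr_pwDr.
move=> k.
have V_le : V (k * B)%N <= rho ^ (k%:Z - 1) * (V 0%N + 1).
  have -> : rho ^ (k%:Z - 1) = rho ^+ k * rho^-1.
    by rewrite expfzDr ?gt_eqF // exprN1.
  apply: le_trans (V_decay 0%N k) _; rewrite -mulrA ler_pM2l ?exprn_gt0 //.
  rewrite mulrC ler_pdivlMr //; have := V_ge0 0%N.
  by move=> V0; apply: le_trans (_ : V 0%N <= _); [rewrite ler_piMr // ltW|lra].
split; first exact: le_trans (f_le_V _) V_le.
apply: le_trans V_le; apply: le_trans (energy_le_V _).
rewrite le_eqVlt; apply/orP; left; apply/eqP; congr (_ * _); apply: esym.
(* The window starting at the shifted index [k * B] is the block of true times starting at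
   [(k - 1) * B]; for [k = 0] these times are negative and both sides vanish. *)
rewrite -[X in \sum_(X <= _ < _) _]add0n big_addn addKn.
apply: eq_bigr => l _; rewrite enorm_sqr /d /shifted_direction.
have -> : (k%:Z - 1) * B%:Z + l%:Z = (l + k * B)%N%:Z - B%:Z by lia.
by [].
Qed.
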